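(* Let $(X,t)$ be an NPLTS. For all $x\in X$ and $w\in A^*$, $$[\![x]\!](w)=\Big[\ \inf\{\Pr_{\mathcal R}(y)(w)\mid \mathcal R=(Y,\mathrm{corr},r)\text{ a resolution of }(X,t),\ \mathrm{corr}(y)=x\},\ \ \sup\{\Pr_{\mathcal R}(y)(w)\mid \mathcal R=(Y,\mathrm{corr},r)\text{ a resolution of }(X,t),\ \mathrm{corr}(y)=x\}\ \Big].$$
   Context: $A$ is a set of labels; $\mathcal{D}X$ is the set of finitely supported probability distributions on $X$, $\delta_x$ the Dirac distribution, $\mathcal{D}f(\Delta)(y)=\sum_{x\in f^{-1}(y)}\Delta(x)$; $\mathrm{conv}$ denotes convex hull. An NPLTS is a pair $(X,t)$ with $t\colon X\to(\mathcal{P}\mathcal{D}X)^A$, each $t(x)(a)$ a finite set of distributions. Terms: $s::=x\ (x\in X)\mid\star\mid s\oplus s\mid s+_p s\ (p\in[0,1])$. For a finite set $S$ of distributions let $\tau(S)=\star$ if $S=\emptyset$, and $\tau(S)=d_1\oplus(d_2\oplus\cdots\oplus d_n)$ if $S=\{\Delta_1,\dots,\Delta_n\}$, where each $d_i$ is a term built from elements of $X$ with $+_p$ only that denotes $\Delta_i$ when $x$ is read as $\delta_x$ and $+_p$ as $(\Phi,\Psi)\mapsto p\Phi+(1-p)\Psi$ (the semantics below does not depend on these choices). For each label $a$ define $s\mapsto s^a$: $x^a=\tau(t(x)(a))$, $\star^a=\star$, $(s_1\oplus s_2)^a=s_1^a\oplus s_2^a$, $(s_1+_ps_2)^a=s_1^a+_ps_2^a$;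 and $s^\varepsilon=s$, $s^{aw}=(s^a)^w$. Let $\mathcal{I}=\{[u,v]\mid 0\le u\le v\le1\}$ and define $o(s)\in\mathcal I$ by $o(x)=[1,1]$, $o(\star)=[0,0]$, $o(s_1\oplus s_2)=[\min(u_1,u_2),\max(v_1,v_2)]$, $o(s_1+_ps_2)=[pu_1+(1-p)u_2,\,pv_1+(1-p)v_2]$ where $o(s_i)=[u_i,v_i]$. The may-must trace semantics is $[\![s]\!](w)=o(s^w)$, in particular $[\![x]\!](w)$ for $x\in X$. A resolution of $(X,t)$ is a triple $(Y,\mathrm{corr},r)$ with $Y$ a set, $\mathrm{corr}\colon Y\to X$, and $r\colon Y\to(\mathcal{D}Y+\{\star\})^A$ such that for all $y\in Y$, $a\in A$: $r(y)(a)=\star$ iff $t(\mathrm{corr}(y))(a)=\emptyset$, and if $r(y)(a)\ne\star$ then $\mathcal{D}(\mathrm{corr})(r(y)(a))\in\mathrm{conv}(t(\mathrm{corr}(y))(a))$. For a resolution, $\Pr_{\mathcal R}\colon Y\to[0,1]^{A^*}$ is defined by $\Pr_{\mathcal R}(y)(\varepsilon)=1$, $\Pr_{\mathcal R}(y)(aw)=0$ if $r(y)(a)=\star$, and $\Pr_{\mathcal R}(y)(aw)=\sum_{y'\in\mathrm{supp}\Delta}\Delta(y')\Pr_{\mathcal R}(y')(w)$ if $r(y)(a)=\Delta$. *)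

(* Defs.v *)
From HB Require Import structures.
From mathcomp Require Import all_boot all_order all_algebra finmap.
From mathcomp Require Import interval_inference.
From mathcomp Require Import boolp classical_sets reals.
Set Implicit Arguments.
Unset Strict Implicit.
Unset Printing Implicit Defensive.
Import Order.TTheory GRing.Theory Num.Theory.
Local Open Scope fset_scope.
Local Open Scope ring_scope.

Section Distributions.
Context {R : realType}.

Definition is_dist (X : choiceType) (f : {fsfun X -> R with 0}) : bool :=
  all (fun x => 0 <= f x) (finsupp f) && (\sum_(x <- finsupp f) f x == 1).

Record dist (X : choiceType) := Dist {
  dist_val :> {fsfun X -> R with 0};
  distP : is_dist dist_val }.

HB.instance Definition _ (X : choiceType) := [isSub for @dist_val X].
HB.instance Definition _ (X : choiceType) := [Choice of dist X by <:].

Section Build.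
Variables (X : choiceType) (S : {fset X}) (f : X -> R).
Hypothesis f_ge0 : forall x, x \in S -> 0 <= f x.
Hypothesis f_sum1 : \sum_(x <- S) f x = 1.

Let g : {fsfun X -> R with 0} := [fsfun x in S => f x | 0].

Lemma mkdist_subproof : is_dist g.
Proof.
have gE x : x \in S -> g x = f x by move=> xS; rewrite fsfunE xS.
have gS : finsupp g `<=` S by exact: finsupp_sub.
apply/andP; split.
  by apply/allP => x /(fsubsetP gS) xS; rewrite gE // f_ge0.
apply/eqP; rewrite -f_sum1 (big_fset_incl _ gS); last first.
  by move=> x _ /fsfun_dflt.
by apply: eq_big_seq => x xS; rewrite gE.
Qed.

Definition mkdist : dist X := Dist mkdist_subproof.

Lemma mkdistE x : mkdist x = if x \in S then f x else 0.
Proof. by rewrite fsfunE. Qed.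
End Build.

Section Theory.
Variable X : choiceType.
Implicit Types D : dist X.

Lemma dist_eqP D D' : D =1 D' -> D = D'.
Proof. by move=> e; apply/val_inj/fsfunP. Qed.

Lemma dist_ge0 D x : 0 <= D x.
Proof.
case/andP: (distP D) => /allP D0 _.
by case: finsuppP => // xD; apply: D0.
Qed.

Lemma dist_sum1 D : \sum_(x <- finsupp D) D x = 1.
Proof. by case/andP: (distP D) => _ /eqP. Qed.

Lemma dist_sum D (S : {fset X}) :
  finsupp D `<=` S -> \sum_(x <- S) D x = 1.
Proof.
move=> sDS; rewrite -(dist_sum1 D) (big_fset_incl _ sDS) //.
by move=> x _ /fsfun_dflt.
Qed.
End Theory.

Section Dirac.
Variables (X : choiceType) (x : X).

Lemma dirac_ge0 y : y \in [fset x] -> 0 <= (y == x)%:R :> R.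
Proof. by rewrite ler0n. Qed.

Lemma dirac_sum1 : \sum_(y <- [fset x]) (y == x)%:R = 1 :> R.
Proof. by rewrite big_seq_fset1 eqxx. Qed.

Definition dist_dirac : dist X := mkdist dirac_ge0 dirac_sum1.

Lemma dist_diracE y : dist_dirac y = (y == x)%:R.
Proof. by rewrite mkdistE inE; case: eqP. Qed.
End Dirac.

Section Mix.
Variables (X : choiceType) (p : {i01 R}) (D1 D2 : dist X).

Let f x := p%:num * D1 x + (1 - p%:num) * D2 x.

Lemma mix_ge0 x : x \in finsupp D1 `|` finsupp D2 -> 0 <= f x.
Proof. by move=> _; rewrite addr_ge0 // mulr_ge0 ?dist_ge0 // subr_ge0. Qed.

Lemma mix_sum1 : \sum_(x <- finsupp D1 `|` finsupp D2) f x = 1.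
Proof.
rewrite big_split /= -!mulr_sumr !dist_sum ?fsubsetUl ?fsubsetUr //.
by rewrite !mulr1 addrCA subrr addr0.
Qed.

Definition dist_mix : dist X := mkdist mix_ge0 mix_sum1.

Lemma dist_mixE x :
  dist_mix x = p%:num * D1 x + (1 - p%:num) * D2 x.
Proof.
rewrite mkdistE; case: ifPn => //; rewrite inE negb_or => /andP[x1 x2].
by rewrite !fsfun_dflt // !mulr0 addr0.
Qed.
End Mix.

Section Map.
Variables (X Y : choiceType) (f : X -> Y) (D : dist X).

Let g y := \sum_(x <- finsupp D | f x == y) D x.

Lemma map_ge0 y : y \in f @` finsupp D -> 0 <= g y.
Proof. by move=> _; apply: sumr_ge0 => x _; exact: dist_ge0. Qed.

Lemma map_sum1 : \sum_(y <- f @` finsupp D) g y = 1.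
Proof. by rewrite -partition_big_imfset dist_sum1. Qed.

Definition dist_map : dist Y := mkdist map_ge0 map_sum1.

Lemma dist_mapE y : dist_map y = \sum_(x <- finsupp D | f x == y) D x.
Proof.
rewrite mkdistE; case: ifPn => // /imfsetP yD; symmetry.
rewrite big_seq_cond big1 // => x /andP[xD /eqP fx].
by case: yD; exists x.
Qed.
End Map.

Definition conv_hull (X : choiceType) (S : {fset dist X}) : set (dist X) :=
  [set D | exists lam : dist X -> R,
     [/\ forall E, E \in S -> 0 <= lam E,
         \sum_(E <- S) lam E = 1 &
         forall x, D x = \sum_(E <- S) lam E * E x]]%classic.

End Distributions.
Arguments dist : clear implicits.

Inductive term (R : realType) (X : Type) : Type :=
| Var of X
| Star
| Oplus of term R X & term R X
| Pplus of {i01 R} & term R X & term R X.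
Arguments Star {R X}.
Arguments Var {R X}.

Section Semantics.
Context {R : realType} {A : Type} {X : choiceType}.

Definition nplts := X -> A -> {fset dist R X}.

(* [denotes d D]: d is built from variables with the operators +_p only,
   and its value in the distributions on X is D. *)
Inductive denotes : term R X -> dist R X -> Prop :=
| denotes_var x : denotes (Var x) (dist_dirac x)
| denotes_pplus p s1 s2 D1 D2 : denotes s1 D1 -> denotes s2 D2 ->
    denotes (Pplus p s1 s2) (dist_mix p D1 D2).

Fixpoint oplus_seq (ss : seq (term R X)) : term R X :=
  match ss with
  | [::] => Star
  | [:: s] => s
  | s :: ss' => Oplus s (oplus_seq ss')
  end.

(* s is one of the terms that tau(S) may stand for: the enumeration Ds of S
   and the terms d D denoting its elements are arbitrary. *)
Definition is_tau (S : {fset dist R X}) (s : term R X) : Prop :=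
  exists (Ds : seq (dist R X)) (d : dist R X -> term R X),
    [/\ uniq Ds, Ds =i S, forall D, D \in S -> denotes (d D) D &
        s = oplus_seq [seq d D | D <- Ds]].

Section Trace.
Variables (t : nplts) (tau : {fset dist R X} -> term R X).

Fixpoint step (s : term R X) (a : A) : term R X :=
  match s with
  | Var x => tau (t x a)
  | Star => Star
  | Oplus s1 s2 => Oplus (step s1 a) (step s2 a)
  | Pplus p s1 s2 => Pplus p (step s1 a) (step s2 a)
  end.

Fixpoint steps (s : term R X) (w : seq A) : term R X :=
  if w is a :: w' then steps (step s a) w' else s.

(* The interval [u, v] is represented by the pair (u, v). *)
Fixpoint obs (s : term R X) : R * R :=
  match s with
  | Var _ => (1, 1)
  | Star => (0, 0)
  | Oplus s1 s2 =>
      (Num.min (obs s1).1 (obs s2).1, Num.max (obs s1).2 (obs s2).2)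
  | Pplus p s1 s2 =>
      (p%:num * (obs s1).1 + (1 - p%:num) * (obs s2).1,
       p%:num * (obs s1).2 + (1 - p%:num) * (obs s2).2)
  end.

Definition maymust (s : term R X) (w : seq A) : R * R := obs (steps s w).
End Trace.

Lemma obs_itv01 s : [/\ 0 <= (obs s).1, (obs s).1 <= (obs s).2 &
                        (obs s).2 <= 1].
Proof.
elim: s => [x||s1 [a1 b1 c1] s2 [a2 b2 c2]|p s1 [a1 b1 c1] s2 [a2 b2 c2]] /=.
- by rewrite ler01.
- by rewrite ler01.
- by rewrite le_min a1 a2 ge_max c1 c2 ge_min !le_max b1.
- have q0 : 0 <= 1 - p%:num by rewrite subr_ge0.
  split; first by rewrite addr_ge0 // mulr_ge0.
    by rewrite lerD // ler_wpM2l.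
  rewrite -[leRHS](subrKC p%:num).
  by rewrite lerD // -[leRHS]mulr1 ler_wpM2l.
Qed.

Record resolution (t : nplts) := Resolution {
  res_car :> choiceType;
  res_corr : res_car -> X;
  res_trans : res_car -> A -> option (dist R res_car); (* None is star *)
  res_star : forall y a, res_trans y a = None <-> t (res_corr y) a = fset0;
  res_conv : forall y a D, res_trans y a = Some D ->
    conv_hull (t (res_corr y) a) (dist_map res_corr D) }.

Fixpoint res_prob (t : nplts) (Y : resolution t) (y : Y) (w : seq A) : R :=
  match w with
  | [::] => 1
  | a :: w' =>
      match res_trans y a with
      | None => 0
      | Some D => \sum_(y' <- finsupp D) D y' * res_prob y' w'
      end
  end.

Definition res_probs (t : nplts) (x : X) (w : seq A) : set R :=
  [set q | exists (Y : resolution t) (y : Y),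
     res_corr y = x /\ q = res_prob y w]%classic.

(* The hypothesis on tau in the main statement is satisfiable. *)
Lemma denotes_exists (D : dist R X) : exists s, denotes s D.
Proof.
have [n] := ubnP #|` finsupp D|; elim: n D => // n IH D leD.
have /fset0Pn [x xD] : finsupp D != fset0.
  apply/eqP => D0; have := dist_sum1 D.
  by rewrite D0 big_seq_fset0 => /esym/eqP; rewrite oner_eq0.
have sumD := dist_sum1 D; rewrite (big_fsetD1 x) //= in sumD.
have sumD' : \sum_(y <- finsupp D `\ x) D y = 1 - D x.
  by apply: (addrI (D x)); rewrite sumD addrC subrK.
have Dx_ge0 := dist_ge0 D x.
have q_ge0 : 0 <= 1 - D x.
  by rewrite -sumD'; apply: sumr_ge0 => y _; exact: dist_ge0.
have Dx_le1 : D x <= 1 by rewrite -subr_ge0.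
have [Dx1|Dx_neq1] := eqVneq (D x) 1.
  exists (Var x); suff -> : D = dist_dirac x by constructor.
  apply: dist_eqP => y; rewrite dist_diracE.
  have [->|yx] := eqVneq y x; first by rewrite Dx1.
  have [yD|/fsfun_dflt //] := boolP (y \in finsupp D).
  move: sumD'; rewrite Dx1 subrr => /eqP.
  rewrite big_seq psumr_eq0 => [|z _]; last exact: dist_ge0.
  by move=> /allP/(_ y); rewrite !inE yx yD /= => /(_ isT)/eqP.
have q_neq0 : 1 - D x != 0 by rewrite subr_eq0 eq_sym.
pose f y := D y / (1 - D x).
have f_ge0 y : y \in finsupp D `\ x -> 0 <= f y.
  by move=> _; rewrite divr_ge0 ?dist_ge0.
have f_sum1 : \sum_(y <- finsupp D `\ x) f y = 1.
  by rewrite -mulr_suml sumD' divff.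
have [|s sD'] := IH (mkdist f_ge0 f_sum1).
  apply: leq_ltn_trans (fsubset_leq_card (finsupp_sub _ _ _)) _.
  by move: leD; rewrite (cardfsD1 x) xD.
exists (Pplus (Itv01 Dx_ge0 Dx_le1) (Var x) s).
suff eD : D = dist_mix (Itv01 Dx_ge0 Dx_le1) (dist_dirac x) (mkdist f_ge0 f_sum1).
  by rewrite {2}eD; constructor => //; constructor.
apply: dist_eqP => y; rewrite dist_mixE dist_diracE mkdistE /= !inE.
have [->|yx] /= := eqVneq y x; first by rewrite mulr1 mulr0 addr0.
rewrite mulr0 add0r; case: ifPn => [_|/fsfun_dflt ->]; last by rewrite mulr0.
by rewrite /f mulrC divfK.
Qed.

Lemma tau_exists :
  exists tau : {fset dist R X} -> term R X, forall S, is_tau S (tau S).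
Proof.
have /choice [d dP] := denotes_exists.
exists (fun S => oplus_seq [seq d D | D <- S]) => S.
by exists (S : seq _), d; split => //; exact: fset_uniq.
Qed.

(* Every state is the image of a state of some resolution, so the infimum and
   the supremum of [res_probs t x w] are those of a nonempty set. *)
Lemma res_probs_neq0 (t : nplts) x w : (res_probs t x w !=set0)%classic.
Proof.
have rP (z : X * A) : exists o : option (dist R X),
    if o is Some D then D \in t z.1 z.2 else t z.1 z.2 = fset0.
  by have [->|/fset0Pn [D DS]] := eqVneq (t z.1 z.2) fset0;
    [exists None|exists (Some D)].
have /choice [r {}rP] := rP.
have H1 y a : r (y, a) = None <-> t y a = fset0.
  have := rP (y, a); case: (r (y, a)) => [D|] //= DS; split => // t0.
  by rewrite t0 in DS.
have H2 y a D : r (y, a) = Some D -> conv_hull (t y a) (dist_map id D).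
  have := rP (y, a) => /[swap] -> /= DS.
  exists (fun E => (E == D)%:R); split => [E _||y'].
  - by rewrite ler0n.
  - rewrite (big_fsetD1 D) //= eqxx big_seq big1 ?addr0 // => E.
    by rewrite !inE => /andP[/negPf ->].
  - rewrite (big_fsetD1 D) //= eqxx mul1r big_seq big1 ?addr0; last first.
      by move=> E; rewrite !inE => /andP[/negPf ->]; rewrite mul0r.
    rewrite dist_mapE; have [yD|yD] := boolP (y' \in finsupp D).
      rewrite big_mkcond (big_fsetD1 y') //= eqxx big_seq big1 ?addr0 // => z.
      by rewrite !inE => /andP[/negPf ->].
    rewrite big_seq_cond big1 ?fsfun_dflt // => z /andP[zD /eqP zy].
    by rewrite -zy zD in yD.
pose Y := @Resolution t X id (fun y a => r (y, a)) H1 H2.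
by exists (res_prob (x : Y) w), Y, x.
Qed.

End Semantics.
Arguments nplts : clear implicits.

(* Main.v *)
(** The term semantics satisfies a Bellman recursion: the two endpoints at
    [a w] are the least and the greatest expectation of the endpoints at [w]
    over the distributions in [t(x)(a)], and both are [0] if there are none.
    Since an expectation is affine in the distribution, passing to convex
    hulls does not exceed these extrema, so every resolution stays between the
    endpoints.  They are attained by the schedulers that choose an extremal
    distribution according to the number of letters already read. *)
Require Import Defs.
From mathcomp Require Import all_boot all_order all_algebra finmap.
From mathcomp Require Import interval_inference.
From mathcomp Require Import boolp classical_sets reals.
Set Implicit Arguments.
Unset Strict Implicit.
Unset Printing Implicit Defensive.
Import Order.TTheory GRing.Theory Num.Theory.
Local Open Scope fset_scope.
Local Open Scope ring_scope.

(** * Expectations under finitely supported distributions and over convex hulls *)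

Section Expectation.
Context {R : realType}.
Implicit Types X Y : choiceType.

Definition expect X (D : dist R X) (f : X -> R) : R :=
  \sum_(x <- finsupp D) D x * f x.

Lemma expect_incl X (D : dist R X) (S : {fset X}) f :
  finsupp D `<=` S -> expect D f = \sum_(x <- S) D x * f x.
Proof.
move=> sDS; rewrite /expect (big_fset_incl _ sDS) //.
by move=> x _ /fsfun_dflt ->; rewrite mul0r.
Qed.

Lemma ler_expect X (D : dist R X) f g :
  (forall x, f x <= g x) -> expect D f <= expect D g.
Proof. by move=> fg; apply: ler_sum => x _; rewrite ler_wpM2l ?dist_ge0. Qed.

Lemma eq_expect X (D : dist R X) f g : f =1 g -> expect D f = expect D g.
Proof. by move=> fg; apply: eq_bigr => x _; rewrite fg. Qed.

Lemma expect_dirac X (x : X) f : expect (dist_dirac x) f = f x.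
Proof.
rewrite (@expect_incl _ _ [fset x]) ?big_seq_fset1 ?dist_diracE ?eqxx ?mul1r //.
exact: finsupp_sub.
Qed.

Lemma expect_mix X p (D1 D2 : dist R X) f :
  expect (dist_mix p D1 D2) f =
  p%:num * expect D1 f + (1 - p%:num) * expect D2 f.
Proof.
rewrite (@expect_incl _ _ (finsupp D1 `|` finsupp D2)) ?finsupp_sub //.
rewrite (expect_incl _ (fsubsetUl (finsupp D1) (finsupp D2))).
rewrite (expect_incl _ (fsubsetUr (finsupp D1) (finsupp D2))).
rewrite !mulr_sumr -big_split /=; apply: eq_bigr => x _.
by rewrite dist_mixE mulrDl !mulrA.
Qed.

Lemma expect_map X Y (h : X -> Y) (D : dist R X) f :
  expect (dist_map h D) f = expect D (f \o h).
Proof.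
rewrite (@expect_incl _ _ (h @` finsupp D)) ?finsupp_sub //.
rewrite /expect (partition_big_imfset _ h) /=.
apply: eq_bigr => y _; rewrite dist_mapE mulr_suml.
by apply: eq_bigr => x /eqP ->.
Qed.

(** Point masses are expectations of indicators, so an equality of distributions can be proved by
    transporting expectations, as in [dist_mapK]. *)
Lemma dist_map_expect X Y (h : X -> Y) (D : dist R X) y :
  dist_map h D y = expect D (fun x => (h x == y)%:R).
Proof.
rewrite dist_mapE big_mkcond; apply: eq_bigr => x _.
by case: eqP; rewrite ?mulr1 ?mulr0.
Qed.

Lemma dist_expect X (D : dist R X) x : D x = expect D (fun y => (y == x)%:R).
Proof.
rewrite (@expect_incl _ _ (x |` finsupp D)) ?fsubsetUr //.
rewrite (big_fsetD1 x) ?fset1U1 //= eqxx mulr1 big_seq big1 ?addr0 // => y.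
by rewrite !inE => /andP[/negPf -> _]; rewrite mulr0.
Qed.

Lemma dist_mapK X Y (h : X -> Y) (k : Y -> X) (D : dist R X) :
  cancel h k -> dist_map k (dist_map h D) = D.
Proof.
move=> hK; apply: dist_eqP => x.
rewrite dist_map_expect expect_map [RHS]dist_expect.
by apply: eq_expect => y /=; rewrite hK.
Qed.

Lemma expect_comb X (S : {fset dist R X}) (lam : dist R X -> R) (D : dist R X) f :
  (forall x, D x = \sum_(E <- S) lam E * E x) ->
  expect D f = \sum_(E <- S) lam E * expect E f.
Proof.
(* [T] contains every support involved: all expectations become sums over [T], and the two finite
   sums can be exchanged. *)
move=> DE; pose T := finsupp D `|` \bigcup_(E <- S) finsupp E.
rewrite (@expect_incl _ _ T) ?fsubsetUl //.
under eq_bigr do rewrite DE mulr_suml.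
rewrite exchange_big /= [LHS]big_seq [RHS]big_seq; apply: eq_bigr => E ES.
rewrite (@expect_incl _ _ T) ?mulr_sumr.
  by apply: eq_bigr => x _; rewrite mulrA.
by apply/fsubsetU/orP; right; apply: bigfcup_sup.
Qed.

Lemma conv_hull_expect_ge X (S : {fset dist R X}) (D : dist R X) f l :
  conv_hull S D -> (forall E, E \in S -> l <= expect E f) -> l <= expect D f.
Proof.
move=> [lam [lam0 lam1 /expect_comb ->]] lE.
(* As the weights sum to 1, [l] is the same combination of copies of [l], and the comparison is
   termwise. *)
rewrite -[leLHS]mul1r -lam1 mulr_suml !big_seq; apply: ler_sum => E ES.
by rewrite ler_wpM2l ?lam0 ?lE.
Qed.

Lemma conv_hull_expect_le X (S : {fset dist R X}) (D : dist R X) f u :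
  conv_hull S D -> (forall E, E \in S -> expect E f <= u) -> expect D f <= u.
Proof.
move=> [lam [lam0 lam1 /expect_comb ->]] Eu.
rewrite -[leRHS]mul1r -lam1 mulr_suml !big_seq; apply: ler_sum => E ES.
by rewrite ler_wpM2l ?lam0 ?Eu.
Qed.

Lemma sub_conv_hull X (S : {fset dist R X}) D : D \in S -> conv_hull S D.
Proof.
move=> DS.
have pick (c : dist R X -> R) : \sum_(E <- S) (E == D)%:R * c E = c D.
  rewrite (big_fsetD1 D) //= eqxx mul1r big_seq big1 ?addr0 // => E.
  by rewrite !inE => /andP[/negPf -> _]; rewrite mul0r.
exists (fun E => (E == D)%:R); split => [E _||x]; rewrite ?ler0n ?pick //.
by rewrite -[RHS](pick (fun=> 1)); apply: eq_bigr => E _; rewrite mulr1.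
Qed.

End Expectation.

(** * Recursion of the term semantics along words *)

Section Semantics.
Context {R : realType} {A : Type} {X : choiceType}.
Variables (t : nplts R A X) (tau : {fset dist R X} -> term R X).
Hypothesis htau : forall S, is_tau S (tau S).

Notation mm := (maymust t tau).

Lemma maymust_star w : mm Star w = (0, 0).
Proof. by elim: w. Qed.

Lemma maymust_oplus s1 s2 w :
  mm (Oplus s1 s2) w =
  (Num.min (mm s1 w).1 (mm s2 w).1, Num.max (mm s1 w).2 (mm s2 w).2).
Proof. by rewrite /maymust; elim: w s1 s2 => //= a w IH s1 s2; rewrite IH. Qed.

Lemma maymust_pplus p s1 s2 w :
  mm (Pplus p s1 s2) w =
  (p%:num * (mm s1 w).1 + (1 - p%:num) * (mm s2 w).1,
   p%:num * (mm s1 w).2 + (1 - p%:num) * (mm s2 w).2).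
Proof. by rewrite /maymust; elim: w s1 s2 => //= a w IH s1 s2; rewrite IH. Qed.

(** Without [Oplus] both endpoints are affine in the term; hence they depend only on the
    distribution denoted, not on the term chosen for it. *)
Lemma maymust_denotes s D w : denotes s D ->
  mm s w = (expect D (fun x => (mm (Var x) w).1),
            expect D (fun x => (mm (Var x) w).2)).
Proof.
elim=> [x|p s1 s2 D1 D2 _ IH1 _ IH2].
  by rewrite !expect_dirac -surjective_pairing.
by rewrite maymust_pplus IH1 IH2 !expect_mix.
Qed.

(** The nested minima and maxima are described as attained bounds, which do not depend on the order
    of the enumeration. *)
Lemma maymust_oplus_seq (I : eqType) (d : I -> term R X) (Ds : seq I) w :
  let m := mm (oplus_seq [seq d D | D <- Ds]) w in
  Ds != [::] ->
  [/\ forall D, D \in Ds -> m.1 <= (mm (d D) w).1 /\ (mm (d D) w).2 <= m.2,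
      exists2 D, D \in Ds & m.1 = (mm (d D) w).1 &
      exists2 D, D \in Ds & m.2 = (mm (d D) w).2].
Proof.
elim: Ds => //= D [_ _|D' Ds /(_ isT)].
  by split=> [E|//|//]; [rewrite inE => /eqP ->|exists D|exists D];
     rewrite ?mem_head.
rewrite [oplus_seq (_ :: _)]/=; set s := oplus_seq _.
move=> [bnd [Dl Dl_in eDl] [Du Du_in eDu]] _.
rewrite maymust_oplus /=; split.
- move=> E; rewrite inE => /predU1P[->|/bnd[lE Eu]].
    by rewrite ge_min le_max !lexx.
  by rewrite ge_min le_max lE Eu !orbT.
- case: leP => _; first by exists D; rewrite ?mem_head.
  by exists Dl; rewrite // inE Dl_in orbT.
- case: leP => _; last by exists D; rewrite ?mem_head.
  by exists Du; rewrite // inE Du_in orbT.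
Qed.

Lemma maymust_cons0 x a w : t x a = fset0 -> mm (Var x) (a :: w) = (0, 0).
Proof.
move=> ta0; rewrite -[LHS]/(mm (tau (t x a)) w).
have [Ds [d [_ eDs _ ->]]] := htau (t x a).
suff -> : Ds = [::] by exact: maymust_star.
by apply/nilP; rewrite /nilp -leqn0 leqNgt -has_predT; apply/hasP => -[D];
  rewrite eDs ta0 inE.
Qed.

(** The Bellman step. The bounds serve the comparison with arbitrary resolutions; the distributions
    attaining them feed the scheduler. *)
Lemma maymust_cons x a w : t x a != fset0 ->
  let m := mm (Var x) (a :: w) in
  let lo y := (mm (Var y) w).1 in let hi y := (mm (Var y) w).2 in
  [/\ forall D, D \in t x a -> m.1 <= expect D lo /\ expect D hi <= m.2,
      exists2 D, D \in t x a & m.1 = expect D lo &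
      exists2 D, D \in t x a & m.2 = expect D hi].
Proof.
move=> ta0 m lo hi; rewrite /m -[mm _ _]/(mm (tau (t x a)) w).
have [Ds [d [_ eDs dP ->]]] := htau (t x a).
have Ds0 : Ds != [::].
  by case/fset0Pn: ta0 => D; rewrite -eDs; case: (Ds).
have [bnd [Dl Dl_in eDl] [Du Du_in eDu]] := maymust_oplus_seq d w Ds0.
move: Dl_in Du_in; rewrite !eDs => Dl_in Du_in; split.
- by move=> D Dt; move: (bnd D); rewrite eDs (maymust_denotes w (dP _ Dt)); apply.
- by exists Dl; rewrite // eDl (maymust_denotes w (dP _ Dl_in)).
- by exists Du; rewrite // eDu (maymust_denotes w (dP _ Du_in)).
Qed.

(** * Resolutions: bounds on their probabilities, and schedulers attaining them *)

Lemma res_prob_bounds (Y : resolution t) (y : Y) w :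
  (mm (Var (res_corr y)) w).1 <= res_prob y w <= (mm (Var (res_corr y)) w).2.
Proof.
elim: w y => [|a w IH] y; first by rewrite /= !lexx.
rewrite [res_prob y _]/=; case rya: (res_trans y a) => [D|]; last first.
  by rewrite maymust_cons0 ?lexx //; apply/res_star.
have ta0 : t (res_corr y) a != fset0.
  by apply/eqP => /res_star; rewrite rya.
have [bnd _ _] := maymust_cons w ta0.
have hull := res_conv rya.
rewrite -/(expect D (fun y' => res_prob y' w)); apply/andP; split.
(* The intermediate value replaces each successor by its image under [res_corr]: the induction
   hypothesis compares pointwise, and the image of [D] lies in the convex hull. *)
- apply: (@le_trans _ _ (expect D
      ((fun x => (mm (Var x) w).1) \o @res_corr _ _ _ _ Y))); last first.
    by apply: ler_expect => z /=; case/andP: (IH z).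
  rewrite -expect_map; apply: (conv_hull_expect_ge hull) => E ES.
  by case: (bnd E ES).
- apply: (@le_trans _ _ (expect D
      ((fun x => (mm (Var x) w).2) \o @res_corr _ _ _ _ Y))).
    by apply: ler_expect => z /=; case/andP: (IH z).
  rewrite -expect_map; apply: (conv_hull_expect_le hull) => E ES.
  by case: (bnd E ES).
Qed.

(* The second component of a state of the resolution counts the letters read
   so far; the labels themselves cannot be stored, as [A] need not be a
   [choiceType]. *)
Lemma res_probs_scheduler (v : X -> seq A -> R) :
  (forall x, v x [::] = 1) ->
  (forall x a w, t x a = fset0 -> v x (a :: w) = 0) ->
  (forall x a w, t x a != fset0 ->
     exists2 D, D \in t x a & v x (a :: w) = expect D (v^~ w)) ->
  forall x w, res_probs t x w (v x w).
Proof.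
move=> v_nil v_cons0 v_cons x w.
(* At counter [n] and label [a] the choice realises [v] on [a] followed by [drop n.+1 w], whether or
   not [a] is the letter of [w] at position [n]. *)
have selP (z : X * nat * A) : exists o : option (dist R X),
    if o is Some D then D \in t z.1.1 z.2 /\
      v z.1.1 (z.2 :: drop z.1.2.+1 w) = expect D (v^~ (drop z.1.2.+1 w))
    else t z.1.1 z.2 = fset0.
  have [->|/v_cons] := eqVneq (t z.1.1 z.2) fset0; first by exists None.
  by case/(_ (drop z.1.2.+1 w)) => D DS vD; exists (Some D).
have /choice [sel {}selP] := selP.
(* All successors carry the counter [y.2.+1]; [fst] undoes this tagging, so the image under [fst] is
   the selected distribution itself. *)
pose r (y : X * nat) a := omap (dist_map (fun z => (z, y.2.+1))) (sel (y, a)).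
have r_star y a : r y a = None <-> t y.1 a = fset0.
  rewrite /r; have := selP (y, a); case: (sel (y, a)) => [D|] //= [DS _].
  by split => // t0; rewrite t0 in DS.
have r_conv y a D : r y a = Some D -> conv_hull (t y.1 a) (dist_map fst D).
  rewrite /r; have := selP (y, a); case: (sel (y, a)) => [E|] //= [ES _] [<-].
  by rewrite dist_mapK //; exact: sub_conv_hull.
pose Y := @Resolution R A X t (X * nat)%type fst r r_star r_conv.
(* The invariant ties the counter to the unread suffix [u]; only on such suffixes were the choices
   made to agree with [v]. *)
have probE u n z : drop n w = u -> res_prob ((z, n) : Y) u = v z u.
  elim: u n z => [|a u IH] n z eu; first by rewrite v_nil.
  have eu' : drop n.+1 w = u by rewrite -addn1 addnC -drop_drop eu /= drop0.
  rewrite /= /r; have := selP ((z, n), a).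
  case: (sel _) => [D|] /=; last by move=> ?; rewrite v_cons0.
  rewrite eu' => -[_ ->].
  apply: (etrans (expect_map _ D (fun y => res_prob (y : Y) u))).
  by apply: eq_expect => y /=; exact: IH.
by exists Y, (x, 0%N); split => //; rewrite probE ?drop0.
Qed.

Lemma res_probs_lo x w : res_probs t x w (mm (Var x) w).1.
Proof.
apply: (@res_probs_scheduler (fun x w => (mm (Var x) w).1)) => // {}x a {}w ta.
  by rewrite maymust_cons0.
by case: (maymust_cons w ta).
Qed.

Lemma res_probs_hi x w : res_probs t x w (mm (Var x) w).2.
Proof.
apply: (@res_probs_scheduler (fun x w => (mm (Var x) w).2)) => // {}x a {}w ta.
  by rewrite maymust_cons0.
by case: (maymust_cons w ta).
Qed.

End Semantics.

Theorem theorem8p4 (R : realType) (A : Type) (X : choiceType)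
    (t : nplts R A X)
    (tau : {fset dist R X} -> term R X)
    (htau : forall S : {fset dist R X}, is_tau S (tau S))
    (x : X) (w : seq A) :
  maymust t tau (Var x) w = (inf (res_probs t x w), sup (res_probs t x w)).
Proof.
set m := maymust t tau (Var x) w.
have lo_in : res_probs t x w m.1 by exact: res_probs_lo.
have hi_in : res_probs t x w m.2 by exact: res_probs_hi.
have bnd q : res_probs t x w q -> m.1 <= q <= m.2.
  by rewrite /m => -[Y [y [<- ->]]]; exact: res_prob_bounds.
have lbm : lbound (res_probs t x w) m.1 by move=> q /bnd /andP[].
have ubm : ubound (res_probs t x w) m.2 by move=> q /bnd /andP[].
(* Both endpoints belong to the set and bound it, which also gives the nonemptiness and boundedness
   that real [inf] and [sup] require. *)
rewrite [LHS]surjective_pairing; congr (_, _); apply/eqP; rewrite eq_le.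
- apply/andP; split; first by apply: lb_le_inf => //; exists m.1.
  by apply: ge_inf => //; exists m.1.
- apply/andP; split; last by apply: ge_sup => //; exists m.1.
  by apply: ub_le_sup => //; exists m.2.
Qed.
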